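(* The diagram formed by $\mathrm{flat}:\mathrm{Dend}(\{x,y\})\to\mathcal{W}_{\{x,y\}}$, $\zeta_{\mathrm{FI}}:\mathcal{W}_{\{x,y\}}\to\mathcal{A}_{\{x,y\}}$ and $\zeta^{\mathrm{Dend}}:\mathrm{Dend}(\{x,y\})\to\mathcal{A}_{\{x,y\}}$ commutes; that is, $$\zeta_{\mathrm{FI}}\circ\mathrm{flat}=\zeta^{\mathrm{Dend}}.$$
   Context: All vector spaces are over a common ground field $\mathbb{K}$. **Dendriform algebras.** A dendriform algebra is a vector space $A$ with bilinear operations $\prec,\succ$ such that, with $x\star y:=x\prec y+x\succ y$, for all $x,y,z\in A$: $(x\prec y)\prec z=x\prec(y\star z)$; $(x\succ y)\prec z=x\succ(y\prec z)$; $(x\star y)\succ z=x\succ(y\succ z)$. ''Dendriform algebra'' always means the augmented one $\overline A=A\oplus\mathbb{K}1$ with $1\prec a=0=a\succ1$, $a\prec1=a=1\succ a$ for $a\in A$ (and $1\star1=1$). A morphism is a linear map sending $1$ to $1$, $A$ to $B$, and preserving $\prec,\succ$ on $A$. **Words.** $\mathcal{W}_{\{x,y\}}$ has basis the finite words on $\{x,y\}$, unit the empty word $\emptyset$. The shuffle product $\star_s$ is defined by $u\star_s\emptyset=\emptyset\star_s u=u$ and, for nonempty $u=u_1\cdots u_n$, $v=v_1\cdots v_k$, $u\star_s v=u\prec v+u\succ v$ with $u\prec v=u_1(u_2\cdots u_n\star_s v)$, $u\succ v=v_1(u\star_s v_2\cdots v_k)$. It is a dendriform algebra. **Shuffles.**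 For $k,l\ge1$, $\mathrm{Sh}(k,l)$ is the set of $\sigma\in S_{k+l}$ with $\sigma(1)<\dots<\sigma(k)$ and $\sigma(k+1)<\dots<\sigma(k+l)$. **Formal integrals.** For $n\in\mathbb{N}$, let $\mathrm{B}_{\mathrm{int}}(\mathbb{R}^n)$ be the set of Borel subsets of $\mathbb{R}^n$ modulo Lebesgue-negligible ones, and $\mathfrak{B}(\mathbb{R}^n)$ the quotient of the algebra $(\mathbb{K}\mathrm{B}_{\mathrm{int}}(\mathbb{R}^n),+,\cup)$ by the ideal generated by the $A\cup B-A-B+A\cap B$. Fix $G$ with $G(x)=g_x:t\mapsto1/t$ and $G(y)=g_y:t\mapsto1/(1-t)$ on $(0,1)$. A formal integral $B\otimes w\times G$, also written $\int_B(\prod_i g_{w_i})\mathrm{d}t_1\cdots\mathrm{d}t_k$, is a pair consisting of an element of $\langle\mathfrak{B}(\mathbb{R}^{\ell(w)})\otimes w\mid w\text{ a word on }\{x,y\}\rangle$ ($\ell$ = length) and of $G$; it is purely formal and vector space operations are those of the first component. $\mathcal{A}_{\{x,y\}}$ is the span of all $\int_{0<t_1<\dots<t_r<1}\prod_{i=1}^r g_{\omega_i}\mathrm{d}t_i$, $r\ge0$ (for $r=0$: $\emptyset\otimes\emptyset\times G$, the unit). For $\alpha=\int_{0<t_1<\dots<t_k<1}\prod_{i=1}^k g_{\omega_i}\mathrm{d}t_i$, $\beta=\int_{0<t_{k+1}<\dots<t_{k+l}<1}\prod_{i=k+1}^{k+l}g_{\omega_i}\mathrm{d}t_i$ ($k,l\ge1$),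 $\alpha\prec\beta$ (resp. $\alpha\succ\beta$) is $\sum_\sigma\int_{0<t_1<\dots<t_{k+l}<1}\prod_{i=1}^{k+l}g_{\omega_{\sigma^{-1}(i)}}\mathrm{d}t_i$ over $\sigma\in\mathrm{Sh}(k,l)$ with $\sigma^{-1}(1)=1$ (resp. $=k+1$). It is a dendriform algebra. $\zeta_{\mathrm{FI}}$ is the linear map $\omega_1\cdots\omega_k\mapsto\int_{0<t_1<\dots<t_k<1}\prod_{i=1}^k g_{\omega_i}\mathrm{d}t_i$, $\emptyset\mapsto\emptyset\otimes\emptyset\times G$. **Binary trees.** $\mathrm{Dend}(\{x,y\})$ is the vector space with basis the planar binary rooted trees (each internal vertex has exactly two children) with internal vertices decorated by $x$ or $y$, including the tree $|$ with no internal vertex. $Y_z$ is the tree with a single internal vertex, decorated by $z$. For trees $t,s\ne|$, let $v_1$ (the root), $\dots,v_k$ be the internal vertices on the rightmost branch of $t$, with decorations $w_1,\dots,w_k$ and left subtrees $F_1,\dots,F_k$; let $v_{k+1}$ (the root), $\dots,v_{k+l}$ be the internal vertices on the leftmost branch of $s$, with decorations $w_{k+1},\dots,w_{k+l}$ and right subtrees $F_{k+1},\dots,F_{k+l}$. For $\sigma\in\mathrm{Sh}(k,l)$, $\sigma(t,s)$ is obtained from the ladder with nodes $1$ (root), $\dots,k+l$, ended above by a leaf, by grafting $F_i$ at node $\sigma(i)$, to the left of the ladder if $i\le k$ and to the right if $i>k$, node $\sigma(i)$ being decorated by $w_i$. Then $t\prec s$ (resp. $t\succ s$) is $\sum\sigma(t,s)$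 over $\sigma\in\mathrm{Sh}(k,l)$ with $\sigma^{-1}(1)=1$ (resp. $=k+1$); $|$ is the unit. It is known that $\mathrm{Dend}(\{x,y\})$ is the free dendriform algebra on $\{x,y\}$ via $z\mapsto Y_z$. **Maps.** $\zeta^{\mathrm{Dend}}$ is the unique dendriform morphism with $\zeta^{\mathrm{Dend}}(Y_z)=\int_{0<t<1}g_z\mathrm{d}t$ (formal integral) for $z\in\{x,y\}$. $\mathrm{flat}$ is the linear map with $\mathrm{flat}(|)=\emptyset$ and, for $t$ with root decorated by $z$ and subtrees $t_1,t_2$ at the children of the root, $\mathrm{flat}(t)=z(\mathrm{flat}(t_1)\star_s\mathrm{flat}(t_2))$ (letter $z$ followed by each word). *)

(* Defs.v *)
From HB Require Import structures.
(* [monalg] must be loaded before [all_analysis]: in the opposite order their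
   notations clash. *)
From mathcomp Require Import finmap monalg.
From mathcomp Require Import all_boot all_order all_algebra all_fingroup.
From mathcomp Require Import generic_quotient ring_quotient.
From mathcomp Require Import all_classical all_reals all_analysis.
From mathcomp Require Import measurable_realfun.

Set Implicit Arguments.
Unset Strict Implicit.
Unset Printing Implicit Defensive.

Import Order.TTheory GRing.Theory Num.Theory.
Local Open Scope classical_set_scope.
Local Open Scope ring_scope.
Local Open Scope quotient_scope.

(* The sigma-algebra on tuples is generated by the coordinates, so that
   [measurable] on [Rn R n] is the Borel sigma-algebra of R^n. *)
Notation Rn R n := (n.-tuple (measurableTypeR R)).

Section lebesgue_Rn.
Variable R : realType.

Definition Rcons n (p : measurableTypeR R * Rn R n) : Rn R n.+1 :=
  cons_tuple p.1 p.2.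

Lemma measurable_Rcons n : measurable_fun [set: _] (@Rcons n).
Proof. by apply: measurable_cons; [exact: measurable_fst|exact: measurable_snd]. Qed.

Section step.
Variables (n : nat) (mu : {sigma_finite_measure set (Rn R n) -> \bar R}).

Definition leb_step : set (Rn R n.+1) -> \bar R :=
  pushforward ((@lebesgue_measure R) \x mu)%E (@Rcons n).

Let leb_step0 : leb_step set0 = 0%E.
Proof. by rewrite /leb_step /pushforward preimage_set0 measure0. Qed.

Let leb_step_ge0 A : (0 <= leb_step A)%E.
Proof. by rewrite /leb_step /pushforward; exact: measure_ge0. Qed.

Let leb_step_sigma_additive : semi_sigma_additive leb_step.
Proof.
move=> F mF tF mUF; rewrite /leb_step /pushforward preimage_bigcup.
apply: measure_semi_sigma_additive.
- by move=> i; rewrite -[X in measurable X]setTI; exact: measurable_Rcons.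
- apply/trivIsetP => i j _ _ ij; rewrite -preimage_setI.
  by move/trivIsetP : tF => /(_ _ _ _ _ ij) ->//; rewrite preimage_set0.
- by rewrite -preimage_bigcup -[X in measurable X]setTI; exact: measurable_Rcons.
Qed.

HB.instance Definition _ := isMeasure.Build _ _ _ leb_step
  leb_step0 leb_step_ge0 leb_step_sigma_additive.

Let leb_step_sigma_finite : sigma_finite [set: Rn R n.+1] leb_step.
Proof.
pose h (t : Rn R n.+1) : measurableTypeR R * Rn R n := (thead t, [tuple of behead t]).
have mh : measurable_fun [set: _] h.
  apply/measurable_fun_pairP; split.
    exact: measurable_tnth.
  exact: measurable_behead.
have hK : cancel (@Rcons n) h by case=> x y; congr pair => /=; apply/val_inj.
have /sigma_finiteP[F [TF ndF Foo]] := sigma_finiteT (@lebesgue_measure R).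
have /sigma_finiteP[G [TG ndG Goo]] := sigma_finiteT mu.
exists (fun k => h @^-1` (F k `*` G k)).
  rewrite -preimage_bigcup [X in _ @^-1` X](_ : _ = setT) ?preimage_setT//.
  rewrite predeqE => -[x y]; split=> // _.
  have [i _ Fix] : (\bigcup_i F i) x by rewrite -TF.
  have [j _ Gjy] : (\bigcup_i G i) y by rewrite -TG.
  exists (maxn i j) => //; split.
    by move: x Fix; exact/subsetPset/ndF/leq_maxl.
  by move: y Gjy; exact/subsetPset/ndG/leq_maxr.
move=> k; have [mF Fk] := Foo k; have [mG Gk] := Goo k; split.
  by rewrite -[X in measurable X]setTI; apply: mh => //; exact: measurableX.
rewrite /leb_step /pushforward -comp_preimage.
have -> : h \o @Rcons n = id by apply/funext => p /=; rewrite hK.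
by rewrite preimage_id product_measure1E// lte_mul_pinfty// ge0_fin_numE.
Qed.

HB.instance Definition _ := Measure_isSigmaFinite.Build _ _ _ leb_step
  leb_step_sigma_finite.

End step.

(* On R^0 this is the Dirac mass: the point is not negligible. *)
Fixpoint lebesgue_Rn n : {sigma_finite_measure set (Rn R n) -> \bar R} :=
  if n is n'.+1 then leb_step (lebesgue_Rn n')
  else \d_([tuple] : Rn R 0).
End lebesgue_Rn.

Section ideal_quotient.
Variables (K : fieldType) (A : comAlgType K) (I : idealr A).

Definition iq_scale (c : K) (x : {ideal_quot I}) : {ideal_quot I} :=
  \pi_({ideal_quot I}) c%:A * x.

Fact iq_scaleA a b x : iq_scale a (iq_scale b x) = iq_scale (a * b) x.
Proof. by rewrite /iq_scale mulrA -rmorphM -scalerAl mul1r scalerA. Qed.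
Fact iq_scale1 : left_id 1 iq_scale.
Proof. by move=> x; rewrite /iq_scale scale1r rmorph1 mul1r. Qed.
Fact iq_scaleDr : right_distributive iq_scale +%R.
Proof. by move=> c x y; rewrite /iq_scale mulrDr. Qed.
Fact iq_scaleDl x : {morph iq_scale^~ x : a b / a + b}.
Proof. by move=> a b; rewrite /iq_scale scalerDl rmorphD mulrDl. Qed.

HB.instance Definition _ := GRing.Zmodule_isLmodule.Build K {ideal_quot I}
  iq_scaleA iq_scale1 iq_scaleDr iq_scaleDl.
End ideal_quotient.

(* The ideal of A generated by G. *)
Definition ideal_span (A : comNzRingType) (G : set A) : {pred A} := fun x =>
  `[< exists2 s : seq (A * A), (forall p, p \in s -> G p.2) &
        x = \sum_(p <- s) p.1 * p.2 >].

Lemma ideal_span_closed (A : comNzRingType) (G : set A) :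
  1 \notin ideal_span G -> idealr_closed (ideal_span G).
Proof.
split=> //; first by apply/asboolP; exists [::]; rewrite ?big_nil.
move=> a _ _ /asboolP[s sG ->] /asboolP[s' sG' ->]; apply/asboolP.
exists ([seq (a * p.1, p.2) | p <- s] ++ s').
  by move=> p; rewrite mem_cat => /orP[/mapP[q /sG Gq ->]|/sG'].
rewrite big_cat big_map mulr_sumr /=; congr (_ + _).
by apply: eq_bigr => p _; rewrite mulrA.
Qed.

Section Bint.
Variables (R : realType) (n : nat).

Record borel := Borel { borel_set :> set (Rn R n); borelP : measurable borel_set }.

HB.instance Definition _ := gen_eqMixin borel.
HB.instance Definition _ := gen_choiceMixin borel.

Definition borelU (A B : borel) := Borel (measurableU _ _ (borelP A) (borelP B)).
Definition borelI (A B : borel) := Borel (measurableI _ _ (borelP A) (borelP B)).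
Definition borel0 := Borel (@measurable0 _ (Rn R n)).

Definition aeeq (A B : borel) : bool :=
  `[< (lebesgue_Rn R n).-negligible (A `+` B) >].

Lemma aeeqS (A B C D : set (Rn R n)) : A `+` B `<=` C `|` D ->
  (lebesgue_Rn R n).-negligible C -> (lebesgue_Rn R n).-negligible D ->
  (lebesgue_Rn R n).-negligible (A `+` B).
Proof. by move=> ABCD C0 D0; apply: negligibleS ABCD _; exact: negligibleU. Qed.

Lemma aeeq_is_equiv : equiv_class_of aeeq.
Proof.
split=> [A|A B|B A C]; rewrite /aeeq.
- by apply/asboolP; rewrite setYK; exact: negligible_set0.
- by rewrite setYC.
- move=> /asboolP AB /asboolP BC; apply/asboolP; apply: aeeqS AB BC.
  move=> t; rewrite /setY /= => -[[At Ct]|[Ct At]]; have [Bt|Bt] := pselect (borel_set B t); tauto.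
Qed.

Canonical aeeq_equiv := EquivRelPack aeeq_is_equiv.
Canonical aeeq_encModRel := defaultEncModRel aeeq.

Definition Bint := {eq_quot aeeq}.
HB.instance Definition _ : EqQuotient borel aeeq Bint := EqQuotient.on Bint.
HB.instance Definition _ := Choice.on Bint.

Definition bint (A : borel) : Bint := \pi_Bint A.

Definition bintU : Bint -> Bint -> Bint := lift_op2 Bint borelU.
Definition bintI : Bint -> Bint -> Bint := lift_op2 Bint borelI.

Lemma bintP (A B : borel) :
  bint A = bint B <-> (lebesgue_Rn R n).-negligible (A `+` B).
Proof.
split=> [/eqP|AB]; last (apply/eqP; rewrite piE; exact/asboolP).
by rewrite piE => /asboolP.
Qed.

Lemma bint_repr (A : borel) : (lebesgue_Rn R n).-negligible (A `+` repr (bint A)).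
Proof. by apply/bintP; rewrite [RHS]reprK. Qed.

Lemma bintUE A B : bintU (bint A) (bint B) = bint (borelU A B).
Proof.
rewrite /bintU; unlock; apply/esym/bintP => /=.
apply: aeeqS (bint_repr A) (bint_repr B) => t.
rewrite /setY /setD /setU /setI /=.
have [Bt|Bt] := pselect (borel_set B t); have [At|At] := pselect (borel_set A t);
have [Bt'|Bt'] := pselect (borel_set (repr (bint B)) t);
have [At'|At'] := pselect (borel_set (repr (bint A)) t); tauto.
Qed.

Lemma bintIE A B : bintI (bint A) (bint B) = bint (borelI A B).
Proof.
rewrite /bintI; unlock; apply/esym/bintP => /=.
apply: aeeqS (bint_repr A) (bint_repr B) => t.
rewrite /setY /setD /setU /setI /=.
have [Bt|Bt] := pselect (borel_set B t); have [At|At] := pselect (borel_set A t);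
have [Bt'|Bt'] := pselect (borel_set (repr (bint B)) t);
have [At'|At'] := pselect (borel_set (repr (bint A)) t); tauto.
Qed.

Lemma bintW (P : Bint -> Prop) : (forall A, P (bint A)) -> forall x, P x.
Proof. by move=> PA x; rewrite -[x]reprK; exact: PA. Qed.

Lemma bint_eq (A B : borel) : A = B :> set _ -> bint A = bint B.
Proof.
case: A B => [A mA] [B mB] /= AB; move: mA mB; rewrite AB => mA mB.
by rewrite (Prop_irrelevance mA mB).
Qed.

Lemma bintUA : associative bintU.
Proof.
elim/bintW=> A; elim/bintW=> B; elim/bintW=> C.
by rewrite !bintUE; apply: bint_eq => /=; rewrite setUA.
Qed.

Lemma bintUC : commutative bintU.
Proof.
elim/bintW=> A; elim/bintW=> B.
by rewrite !bintUE; apply: bint_eq => /=; rewrite setUC.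
Qed.

Lemma bint0U : left_id (bint borel0) bintU.
Proof. by elim/bintW=> A; rewrite bintUE; apply: bint_eq => /=; rewrite set0U. Qed.

Lemma bintU0 : right_id (bint borel0) bintU.
Proof. by move=> x; rewrite bintUC bint0U. Qed.

Lemma bintU_eq0 x y :
  bintU x y = bint borel0 -> x = bint borel0 /\ y = bint borel0.
Proof.
elim/bintW: x => A; elim/bintW: y => B; rewrite bintUE.
move=> /bintP /=; rewrite setY0 => AB0; split; apply/bintP; rewrite /= setY0.
- by apply: negligibleS AB0; exact: subsetUl.
- by apply: negligibleS AB0; exact: subsetUr.
Qed.

HB.instance Definition _ := Choice_isMonomialDef.Build Bint
  bintUA bint0U bintU0 bintU_eq0.
HB.instance Definition _ := MonomialDef_isConomialDef.Build Bint bintUC.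

End Bint.

(* The product of [KB] comes from the monoid structure ([bintU], [bint borel0])
   put on [Bint] above: it is the linear extension of the union. *)
Section frakB.
Variables (K : fieldType) (R : realType) (n : nat).

Local Notation KB := {malg K[Bint R n]}.

Definition incl_excl (A B : Bint R n) : KB :=
  << bintU A B >> - << A >> - << B >> + << bintI A B >>.

Definition frakB_ideal : {pred KB} :=
  ideal_span [set incl_excl AB.1 AB.2 | AB in [set: Bint R n * Bint R n]].

Let one_of : Bint R n -> K := fun=> 1.

Let one_of_mmorphism : mmorphism one_of.
Proof. by split=> // A B; rewrite /one_of mulr1. Qed.

HB.instance Definition _ :=
  monalg.isMultiplicative.Build (Bint R n) K one_of one_of_mmorphism.

Definition augKB : {rmorphism KB -> K} := mmap idfun one_of.

Lemma augKBU c A : augKB << c *g A >> = c.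
Proof. by rewrite /= mmapU /= mulr1. Qed.

Lemma aug_incl_excl A B : augKB (incl_excl A B) = 0.
Proof. by rewrite /incl_excl !(rmorphD, rmorphN) /= !mmapU /= !mulr1 subrr add0r addNr. Qed.

Lemma frakB_ideal_aug x : x \in frakB_ideal -> augKB x = 0.
Proof.
move=> /asboolP[s sG ->]; rewrite rmorph_sum big_seq big1 // => p /sG[AB _ <-].
by rewrite rmorphM aug_incl_excl mulr0.
Qed.

Lemma frakB_ideal_closed : idealr_closed frakB_ideal.
Proof.
apply: ideal_span_closed; apply/negP => /frakB_ideal_aug/eqP.
by rewrite rmorph1 oner_eq0.
Qed.

HB.instance Definition _ := isIdealr.Build KB frakB_ideal frakB_ideal_closed.

Definition frakB := {ideal_quot frakB_ideal}.
HB.instance Definition _ := GRing.Lmodule.on frakB.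

Definition frakB_class (A : Bint R n) : frakB := \pi_frakB (<< A >> : KB).

Lemma frakB_class_neq0 A : frakB_class A != 0.
Proof.
rewrite -[0](rmorph0 \pi_frakB) /frakB_class -Quotient.idealrBE subr0.
apply/negP => /frakB_ideal_aug; rewrite augKBU => /eqP; exact/negP/oner_neq0.
Qed.

End frakB.

(* The direct sum of the V i: the families with finite support. *)
Section direct_sum.
Variables (K : fieldType) (I : choiceType) (V : I -> lmodType K).

Record dsum := DSum {
  dsum_fun :> forall i, V i;
  dsum_finite : finite_set [set i | dsum_fun i != 0] }.

HB.instance Definition _ := gen_eqMixin dsum.
HB.instance Definition _ := gen_choiceMixin dsum.

Lemma dsumP (x y : dsum) : (forall i, x i = y i) -> x = y.
Proof.
case: x y => [f ff] [g gf] /= fg.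
have {}fg : f = g by apply: functional_extensionality_dep.
by move: ff gf; rewrite fg => ff gf; rewrite (Prop_irrelevance ff gf).
Qed.

Fact dsum0_finite : finite_set [set i | (0 : V i) != 0].
Proof.
by rewrite (_ : [set _ | _] = set0)// predeqE => i; split=> //=; rewrite eqxx.
Qed.

Fact dsumN_finite (x : dsum) : finite_set [set i | - x i != 0].
Proof. by under eq_set do rewrite oppr_eq0; exact: dsum_finite. Qed.

Fact dsumD_finite (x y : dsum) : finite_set [set i | x i + y i != 0].
Proof.
apply: (@sub_finite_set _ _ ([set i | x i != 0] `|` [set i | y i != 0])).
  move=> i /=; have [->|?] := eqVneq (x i) 0; last by left.
  by rewrite add0r; right.
by rewrite finite_setU; split; exact: dsum_finite.
Qed.

Fact dsumZ_finite a (x : dsum) : finite_set [set i | a *: x i != 0].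
Proof.
apply: sub_finite_set (dsum_finite x) => i /=.
by apply: contra_neq => ->; rewrite scaler0.
Qed.

Definition dsum0 := DSum dsum0_finite.
Definition dsumN x := DSum (dsumN_finite x).
Definition dsumD x y := DSum (dsumD_finite x y).
Definition dsumZ a x := DSum (dsumZ_finite a x).

Fact dsumA : associative dsumD.
Proof. by move=> x y z; apply: dsumP => i; exact: addrA. Qed.
Fact dsumC : commutative dsumD.
Proof. by move=> x y; apply: dsumP => i; exact: addrC. Qed.
Fact dsum0D : left_id dsum0 dsumD.
Proof. by move=> x; apply: dsumP => i; exact: add0r. Qed.
Fact dsumND : left_inverse dsum0 dsumN dsumD.
Proof. by move=> x; apply: dsumP => i; exact: addNr. Qed.

HB.instance Definition _ := GRing.isZmodule.Build dsum dsumA dsumC dsum0D dsumND.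

Fact dsumZA a b x : dsumZ a (dsumZ b x) = dsumZ (a * b) x.
Proof. by apply: dsumP => i; exact: scalerA. Qed.
Fact dsum1Z : left_id 1 dsumZ.
Proof. by move=> x; apply: dsumP => i; exact: scale1r. Qed.
Fact dsumZDr : right_distributive dsumZ +%R.
Proof. by move=> a x y; apply: dsumP => i; exact: scalerDr. Qed.
Fact dsumZDl x : {morph dsumZ^~ x : a b / a + b}.
Proof. by move=> a b; apply: dsumP => i; exact: scalerDl. Qed.

HB.instance Definition _ := GRing.Zmodule_isLmodule.Build K dsum
  dsumZA dsum1Z dsumZDr dsumZDl.

Fact dsum_single_finite i (x : V i) :
  finite_set [set j | eqtype.dfwith (T := V) (fun=> 0) x j != 0].
Proof.
apply: (@sub_finite_set _ _ [set i]); last exact: finite_set1.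
move=> j /=; apply: contra_neqP => /eqP ji.
by rewrite eqtype.dfwith_out// eq_sym.
Qed.

Definition dsum_single i (x : V i) := DSum (dsum_single_finite x).

End direct_sum.

Section linear_extension.
Variables (K : fieldType) (X : choiceType) (V : lmodType K).

(* Linear extension of a map given on the basis X. *)
Definition linext (f : X -> V) (p : {malg K[X]}) : V :=
  \sum_(x <- msupp p) p@_x *: f x.

Lemma linextEw f p (d : {fset X}) : (msupp p `<=` d)%fset ->
  linext f p = \sum_(x <- d) p@_x *: f x.
Proof.
move=> pd; rewrite /linext (big_fset_incl _ pd)//= => x _.
by move/mcoeff_outdom ->; rewrite scale0r.
Qed.

Lemma linextU f x : linext f << x >> = f x.
Proof. by rewrite (linextEw _ msuppU_le) big_seq_fset1 mcoeffUU scale1r. Qed.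

Lemma linext_is_linear f : linear (linext f).
Proof.
move=> a p q; set d := (msupp (a *: p + q) `|` msupp p `|` msupp q)%fset.
rewrite !(@linextEw _ _ d); last 3 first.
- exact: fsubsetUr.
- by rewrite fsubsetU// fsubsetUr.
- by rewrite fsubsetU// fsubsetUl.
rewrite scaler_sumr -big_split /=; apply: eq_bigr => x _.
by rewrite mcoeffD mcoeffZ scalerDl scalerA.
Qed.

HB.instance Definition _ f :=
  GRing.isLinear.Build K {malg K[X]} V *:%R (linext f) (linext_is_linear f).

End linear_extension.

Definition bilext (K : fieldType) (X Y : choiceType) (V : lmodType K)
    (f : X -> Y -> V) (p : {malg K[X]}) (q : {malg K[Y]}) : V :=
  linext (fun x => linext (f x) q) p.

Section augmented_dendriform.
Variable K : fieldType.

(* The data of an augmented dendriform algebra K1 + A: [dend_aug] is A.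
   Only these data enter the notion of morphism.  The operations are total
   maps on K1 + A; [dend_prec 1 1] and [dend_succ 1 1], which have no meaning,
   are 0 in the instances below, and no morphism condition mentions them. *)
Record augDend := AugDend {
  dend_carrier :> lmodType K;
  dend_one : dend_carrier;
  dend_aug : set dend_carrier;
  dend_prec : dend_carrier -> dend_carrier -> dend_carrier;
  dend_succ : dend_carrier -> dend_carrier -> dend_carrier }.

Definition dend_morphism (D E : augDend) (f : D -> E) : Prop :=
  [/\ linear f, f (dend_one D) = dend_one E,
      forall a, dend_aug a -> dend_aug (f a),
      forall a b, dend_aug a -> dend_aug b ->
        f (dend_prec a b) = dend_prec (f a) (f b) &
      forall a b, dend_aug a -> dend_aug b ->
        f (dend_succ a b) = dend_succ (f a) (f b)].

End augmented_dendriform.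

Section shuffles.
Variables k l : nat.

(* Indices start at 0: the positions 1, ..., k of the source are i < k, and
   k+1, ..., k+l are k <= i. *)
Definition shuffle (s : 'S_(k + l)) : bool :=
  [forall i : 'I_(k + l), forall j : 'I_(k + l),
    (i < j)%N && ((j < k)%N || (k <= i)%N) ==> (s i < s j)%N].

(* s^-1(first position) = m *)
Definition first_comes_from (m : nat) (s : 'S_(k + l)) : bool :=
  [forall i : 'I_(k + l), (i == 0 :> nat) ==> ((s^-1)%g i == m :> nat)].

Definition shuffle_prec s := shuffle s && first_comes_from 0 s.
Definition shuffle_succ s := shuffle s && first_comes_from k s.

(* The sequence whose i-th item is the s^-1(i)-th item of u ++ v. *)
Definition interleave (T : Type) (s : 'S_(k + l)) (u : k.-tuple T)
    (v : l.-tuple T) : seq T :=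
  [seq tnth (cat_tuple u v) ((s^-1)%g i) | i <- enum 'I_(k + l)].

End shuffles.

Variant letter := Lx | Ly.

Definition bool_of_letter z := if z is Lx then true else false.
Definition letter_of_bool b := if b then Lx else Ly.
Lemma bool_of_letterK : cancel bool_of_letter letter_of_bool.
Proof. by case. Qed.
HB.instance Definition _ := Choice.copy letter (can_type bool_of_letterK).

Definition word := seq letter.
HB.instance Definition _ := Choice.on word.

Section words.
Variable K : fieldType.

Definition W := {malg K[word]}.
HB.instance Definition _ := GRing.Lmodule.on W.

Definition wcons (z : letter) : W -> W := linext (fun w => << z :: w >>).

(* For u = z u' and v = z' v', the first term is u prec v and the second one
   is u succ v. *)
Fixpoint word_shuffle (u : word) : word -> W :=
  fix shuffle_u (v : word) : W :=
    match u, v with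
    | [::], _ => << v >>
    | _, [::] => << u >>
    | z :: u', z' :: v' =>
        wcons z (word_shuffle u' v) + wcons z' (shuffle_u v')
    end.

Definition wshuffle : W -> W -> W := bilext word_shuffle.

End words.

Inductive btree := Leaf | Node of letter & btree & btree.

Fixpoint gentree_of_btree (t : btree) : GenTree.tree letter :=
  if t is Node z l r then
    GenTree.Node 1 [:: GenTree.Leaf z; gentree_of_btree l; gentree_of_btree r]
  else GenTree.Node 0 [::].
Fixpoint btree_of_gentree (t : GenTree.tree letter) : btree :=
  if t is GenTree.Node 1 [:: GenTree.Leaf z; l; r] then
    Node z (btree_of_gentree l) (btree_of_gentree r)
  else Leaf.
Lemma gentree_of_btreeK : cancel gentree_of_btree btree_of_gentree.
Proof. by elim=> [|z l IHl r IHr] //=; rewrite IHl IHr. Qed.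
HB.instance Definition _ := Choice.copy btree (can_type gentree_of_btreeK).

Definition Y z := Node z Leaf Leaf.

(* A node of a ladder: the side of the ladder on which its subtree is grafted
   ([true] for left), its decoration, and this subtree. *)
Fixpoint right_spine (t : btree) : seq (bool * letter * btree) :=
  if t is Node z l r then (true, z, l) :: right_spine r else [::].
Fixpoint left_spine (t : btree) : seq (bool * letter * btree) :=
  if t is Node z l r then (false, z, r) :: left_spine l else [::].

Definition ladder : seq (bool * letter * btree) -> btree :=
  foldr (fun n rest => let: (on_left, z, F) := n in
           if on_left then Node z F rest else Node z rest F) Leaf.

Definition tree_shuffle (t s : btree)
    (sigma : 'S_(size (right_spine t) + size (left_spine s))) : btree :=
  ladder (interleave sigma (in_tuple (right_spine t)) (in_tuple (left_spine s))).

Section dend.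
Variable K : fieldType.

Definition tree_prec (t s : btree) : {malg K[btree]} :=
  match t, s with
  | Leaf, _ => 0
  | _, Leaf => << t >>
  | _, _ => \sum_(sigma | shuffle_prec sigma) << tree_shuffle (t:=t) (s:=s) sigma >>
  end.

Definition tree_succ (t s : btree) : {malg K[btree]} :=
  match t, s with
  | _, Leaf => 0
  | Leaf, _ => << s >>
  | _, _ => \sum_(sigma | shuffle_succ sigma) << tree_shuffle (t:=t) (s:=s) sigma >>
  end.

Definition Dend : augDend K := AugDend << Leaf >>
  [set p : {malg K[btree]} | p@_Leaf = 0] (bilext tree_prec) (bilext tree_succ).

Fixpoint flat_tree (t : btree) : W K :=
  if t is Node z l r then wcons z (wshuffle (flat_tree l) (flat_tree r))
  else << [::] >>.

Definition flat : Dend -> W K := linext flat_tree.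
End dend.

Definition open01 (R : realType) : set R := `]0, 1[.
Arguments open01 : clear implicits.

Section formal_integrals.
Variables (K : fieldType) (R : realType).

(* A formal integral is a pair of a vector and of G; as only vectors with the
   same G are ever combined, G is a parameter of the type.  The summand
   B(R^l(w)) (x) w is represented by the component of index w. *)
Definition formal_integral (G : letter -> open01 R -> R) : Type :=
  dsum (fun w : word => frakB K R (size w)).
HB.instance Definition _ G := GRing.Lmodule.on (formal_integral G).

(* B (x) w x G *)
Definition formal_int G (w : word) (B : borel R (size w)) : formal_integral G :=
  dsum_single (V := fun w : word => frakB K R (size w)) (frakB_class K (bint B)).

Definition gxy (z : letter) (t : open01 R) : R :=
  match z with Lx => 1 / set_val t | Ly => 1 / (1 - set_val t) end.

(* 0 < t_1 < ... < t_n < 1 *)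
Definition simplex n : set (Rn R n) :=
  [set t : Rn R n | path <%R (0 : R) (rcons t 1)].

Lemma measurable_simplex n : measurable (@simplex n).
Proof.
pose f i (t : Rn R n) : measurableTypeR R := nth 1 (0 :: rcons t 1) i.
have mf i : measurable_fun [set: Rn R n] (f i).
  case: i => [|i]; first exact: measurable_cst.
  have [ltin|lein] := ltnP i n.
    rewrite (_ : f _ = fun t => tnth t (Ordinal ltin)).
      exact: measurable_tnth.
    apply/funext => t.
    by rewrite /f/= nth_rcons size_tuple ltin (tnth_nth 1).
  rewrite (_ : f _ = fun=> 1); first exact: measurable_cst.
  by apply/funext => t; rewrite /f/= nth_rcons size_tuple ltnNge lein/= if_same.
rewrite (_ : @simplex n = \bigcap_(i in `I_n.+1) [set t | f i t < f i.+1 t]).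
  apply: bigcap_measurable => [|i _]; first by exists 0%N.
  rewrite -[X in measurable X]setTI.
  have mT : measurable [set true] by [].
  exact: (measurable_fun_ltr (mf i) (mf i.+1) measurableT mT).
rewrite predeqE => t; split => [/(pathP 1) st i /= ltin|st].
  by apply: st; rewrite size_rcons size_tuple.
by apply/(pathP 1) => i; rewrite size_rcons size_tuple; exact: st.
Qed.

(* The unit is (empty set) (x) (empty word), the class of the empty set being
   the unit of the algebra B(R^0). *)
Definition simplex_domain n : borel R n :=
  if n is m.+1 then Borel (@measurable_simplex m.+1) else borel0 R 0.

Definition simplex_int (w : word) : formal_integral gxy :=
  formal_int gxy (simplex_domain (size w)).

Definition in_calA : {pred formal_integral gxy} :=
  fun x => `[< exists p : W K, x = linext simplex_int p >].

Fact in_calA_submod : submod_closed in_calA.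
Proof.
split; first by apply/asboolP; exists 0; rewrite linear0.
move=> a _ _ /asboolP[p ->] /asboolP[q ->]; apply/asboolP.
by exists (a *: p + q); rewrite linearP.
Qed.
HB.instance Definition _ := GRing.isSubmodClosed.Build K _ in_calA in_calA_submod.

Record calA := CalA { calA_val : formal_integral gxy; _ : calA_val \in in_calA }.
HB.instance Definition _ := [isSub for calA_val].
HB.instance Definition _ := [Choice of calA by <:].
HB.instance Definition _ := [SubChoice_isSubLmodule of calA by <:].

Fact simplex_int_in w : simplex_int w \in in_calA.
Proof. by apply/asboolP; exists << w >>; rewrite linextU. Qed.

Definition simplexA (w : word) : calA := CalA (simplex_int_in w).

Definition zetaFI : W K -> calA := linext simplexA.

Lemma val_zetaFI p : calA_val (zetaFI p) = linext simplex_int p.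
Proof.
rewrite -[calA_val _]/(val (zetaFI p)) /zetaFI /linext raddf_sum.
by apply: eq_bigr => w _.
Qed.

(* The integrals over the simplices form a basis of [calA], so that its
   operations are determined by their values on them. *)
Lemma zetaFI_surj (a : calA) : exists p, zetaFI p = a.
Proof.
case: a => x xA; have /asboolP[p xp] := xA; exists p.
by apply/val_inj; rewrite /= val_zetaFI.
Qed.

Lemma linext_simplex_int p w : linext simplex_int p w =
  p@_w *: frakB_class K (bint (simplex_domain (size w))).
Proof.
have evalE (s : seq word) : (\sum_(u <- s) p@_u *: simplex_int u) w =
    \sum_(u <- s) p@_u *: simplex_int u w.
  by elim: s => [|u s IHs]; rewrite ?big_nil// !big_cons -IHs.
rewrite (@linextEw _ _ _ _ _ (w |` msupp p)%fset) ?fsubsetU1// evalE.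
rewrite (big_fsetD1 w) ?fset1U1//= big1_seq ?addr0.
  by rewrite /simplex_int /formal_int /= eqtype.dfwith_in.
move=> u; rewrite in_fsetD1 => /andP[_ /andP[uw _]].
by rewrite /simplex_int /formal_int /= eqtype.dfwith_out// scaler0.
Qed.

Lemma zetaFI_inj : injective zetaFI.
Proof.
move=> p q /(congr1 calA_val); rewrite !val_zetaFI => pq.
apply/malgP => w; move/(congr1 (fun x : formal_integral gxy => x w)): pq.
rewrite !linext_simplex_int => /eqP; rewrite -subr_eq0 -scalerBl.
by rewrite scaler_eq0 subr_eq0 (negPf (@frakB_class_neq0 _ _ _ _)) orbF => /eqP.
Qed.

Definition wcoord (a : calA) : W K := sval (cid (zetaFI_surj a)).

Lemma wcoordK : cancel wcoord zetaFI.
Proof. by move=> a; rewrite /wcoord; case: cid. Qed.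

Lemma zetaFIK : cancel zetaFI wcoord.
Proof. by move=> p; apply: zetaFI_inj; rewrite wcoordK. Qed.

Definition int_prec (u v : word) : calA :=
  match u, v with
  | [::], _ => 0
  | _, [::] => simplexA u
  | _, _ => \sum_(sigma | shuffle_prec sigma)
      simplexA (interleave sigma (in_tuple u) (in_tuple v))
  end.

Definition int_succ (u v : word) : calA :=
  match u, v with
  | _, [::] => 0
  | [::], _ => simplexA v
  | _, _ => \sum_(sigma | shuffle_succ sigma)
      simplexA (interleave sigma (in_tuple u) (in_tuple v))
  end.

Definition calA_dend : augDend K :=
  AugDend (simplexA [::])
    [set a | exists2 p : W K, p@_[::] = 0 & a = zetaFI p]
    (fun a b => bilext int_prec (wcoord a) (wcoord b))
    (fun a b => bilext int_succ (wcoord a) (wcoord b)).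

Definition is_zetaDend (f : Dend K -> calA_dend) : Prop :=
  dend_morphism f /\ forall z, f << Y z >> = simplexA [:: z].

End formal_integrals.

(* Main.v *)
(** The shuffle permutations of positions [k + l] are in bijection, by
    [s |-> s^-1] in one-line notation, with the sequences obtained by recursively
    shuffling the two blocks of positions.  Hence the half-products of words, of
    formal integrals and of trees all obey the same recursion: [prec] detaches the
    first letter (or the root and its left subtree) of its first argument and
    [succ] that of its second one.  Along it, [flat] turns the product of trees
    into the shuffle product; the only other input is the associativity of the
    latter, which gives e.g.
      flat ((z l r) prec s) = z (flat l * (flat r * flat s))
                            = (z (flat l * flat r)) prec flat s.
    So [zetaFI o flat] is a dendriform morphism with the prescribed values on the
    [Y z]; it is the only one since [Node z l r = (l succ Y z) prec r], a half-product
    by a leaf being omitted. *)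

From HB Require Import structures.
(* [monalg] must be loaded before [Defs], which loads [all_analysis]: in the
   opposite order their notations clash. *)
From mathcomp Require Import finmap monalg.
Require Import Defs.
From mathcomp Require Import all_boot all_algebra all_reals.
From mathcomp Require Import all_fingroup.

Set Implicit Arguments.
Unset Strict Implicit.
Unset Printing Implicit Defensive.

Import GRing.Theory.
Local Open Scope ring_scope.

(** * Shuffles of two sequences, by recursion *)

(** The nested recursion of [word_shuffle], with a list in place of the sum and over any type, so
    that it serves positions, words and spines of trees alike. *)
Fixpoint shuffles (T : Type) (u : seq T) : seq T -> seq (seq T) :=
  fix shuf_u (v : seq T) : seq (seq T) :=
    match u, v with
    | [::], _ => [:: v]
    | _, [::] => [:: u]
    | a :: u', b :: v' => map (cons a) (shuffles u' v) ++ map (cons b) (shuf_u v')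
    end.

Arguments shuffles : simpl never.

Lemma shuffles_cons T (a b : T) u v :
  shuffles (a :: u) (b :: v) =
  map (cons a) (shuffles u (b :: v)) ++ map (cons b) (shuffles (a :: u) v).
Proof. by []. Qed.

Lemma shuffles0s T (v : seq T) : shuffles [::] v = [:: v].
Proof. by case: v. Qed.

Lemma shuffless0 T (u : seq T) : shuffles u [::] = [:: u].
Proof. by case: u. Qed.

Lemma shuffles_map (T U : Type) (f : T -> U) (u v : seq T) :
  shuffles (map f u) (map f v) = map (map f) (shuffles u v).
Proof.
elim: u v => [|a u IHu] v; first by rewrite !shuffles0s.
elim: v => [|b v IHv] //=; rewrite !shuffles_cons map_cat -map_comp.
by rewrite -/(map f (b :: v)) -/(map f (a :: u)) IHu IHv -!map_comp.
Qed.

Section separated.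
Variables (T : eqType) (p : pred T).

Lemma mem_map_cons (a x : T) (s : seq (seq T)) (w : seq T) :
  (x :: w \in map (cons a) s) = (x == a) && (w \in s).
Proof.
apply/mapP/andP => [[w' ws [-> ->]]|[/eqP-> ws]]; first by rewrite eqxx.
by exists w.
Qed.

(* When [p] tells the letters of [u] from those of [v], a shuffle of [u] and [v] is
   recognised by filtering with [p]. *)
Lemma shuffles_sepE (u v : seq T) : all p u -> all (predC p) v -> forall w,
  (w \in shuffles u v) = (filter p w == u) && (filter (predC p) w == v).
Proof.
move=> + + w; elim: w u v => [|x w IHw] [|a u] [|b v] //=.
- by rewrite shuffles_cons mem_cat; do 2!case: mapP => [[]//|_].
- by move=> _ _; case: (p x); rewrite /= ?andbF.
- move=> _ /andP[npb pv]; have [px|npx] := boolP (p x) => /=.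
    rewrite inE eqseq_cons; apply/negbTE; rewrite negb_and.
    by apply/orP; left; apply: contraNneq npb => <-; rewrite px.
  have -> : (x :: w \in [:: b :: v]) = (x == b) && (w \in shuffles [::] v).
    by rewrite shuffles0s !inE eqseq_cons.
  by rewrite IHw // eqseq_cons andbCA.
- move=> /andP[pa pu] _.
  have -> : (x :: w \in [:: a :: u]) = (x == a) && (w \in shuffles u [::]).
    by rewrite shuffless0 !inE eqseq_cons.
  rewrite IHw //; have [px|npx] := boolP (p x) => /=.
    by rewrite eqseq_cons andbA.
  rewrite andbF; apply/negbTE; rewrite negb_and; apply/orP; left.
  by apply: contraNneq npx => ->.
move=> /andP[pa pu] /andP[npb pv]; rewrite shuffles_cons mem_cat !mem_map_cons.
rewrite !IHw //= ?npb ?pa //.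
have [px|npx] := boolP (p x) => /=; rewrite !eqseq_cons.
  by rewrite (_ : (x == b) = false) ?orbF ?andbA //; apply: contraNF npb => /eqP <-.
have xa : (x == a) = false by apply: contraNF npx => /eqP ->.
by rewrite xa /= andbCA.
Qed.

(** The first letter satisfies [p] in one branch of the recursion and not in the other, so the two
    branches are disjoint. *)
Lemma shuffles_uniq (u v : seq T) : all p u -> all (predC p) v -> uniq (shuffles u v).
Proof.
have cI (a : T) : injective (cons a) by move=> s t [].
elim: u v => [|a u IHu] v; first by rewrite shuffles0s.
elim: v => [|b v IHv] //= /[dup] pau /andP[pa pu] /[dup] pbv /andP[npb pv].
rewrite shuffles_cons cat_uniq !map_inj_uniq ?IHu ?IHv ?andbT //=.
apply/hasPn => _ /mapP[w _ ->]; rewrite mem_map_cons.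
by apply: contraNN npb => /andP[/eqP ->].
Qed.
End separated.

(** * Shuffle permutations as shuffles of two blocks of positions *)

Section shuffle_permutations.
Variables k l : nat.
Implicit Type s : 'S_(k + l).

Let lows := [seq lshift l i | i <- enum 'I_k].
Let highs := [seq rshift k j | j <- enum 'I_l].

(* One-line notation of [s^-1]: reading [u ++ v] along it gives [interleave s u v]. *)
Definition source_seq s := [seq (s^-1)%g i | i <- enum 'I_(k + l)].

Let low (i : 'I_(k + l)) := (i < k)%N.

Let lows_low : all low lows.
Proof. by apply/allP => _ /mapP[i _ ->]; rewrite /low /= ltn_ord. Qed.

Let highs_high : all (predC low) highs.
Proof.
by apply/allP => _ /mapP[i _ ->]; rewrite /low /= -leqNgt leq_addr.
Qed.

Let mem_lows i : (i \in lows) = low i.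
Proof.
apply/idP/idP => [/(allP lows_low)//|ik].
by apply/mapP; exists (Ordinal ik); rewrite ?mem_enum //; apply/val_inj.
Qed.

Let mem_highs i : (i \in highs) = ~~ low i.
Proof.
apply/idP/idP => [/(allP highs_high)//|]; rewrite /low.
case: (split_ordP i) => j -> /=; rewrite ?ltn_ord // => _.
by apply/mapP; exists j; rewrite ?mem_enum.
Qed.

Let pairwise_enum n : pairwise (fun i j : 'I_n => (i < j)%N) (enum 'I_n).
Proof.
have := iota_ltn_sorted 0 n; rewrite (sorted_pairwise ltn_trans).
by rewrite -val_enum_ord pairwise_map.
Qed.

Let lows_incr : pairwise (fun i j : 'I_(k + l) => (i < j)%N) lows.
Proof. by rewrite pairwise_map; exact: pairwise_enum. Qed.

Let highs_incr : pairwise (fun i j : 'I_(k + l) => (i < j)%N) highs.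
Proof.
rewrite pairwise_map; apply: sub_pairwise (pairwise_enum l) => i j /=.
by rewrite ltn_add2l.
Qed.

Lemma source_seq_inj : injective source_seq.
Proof.
move=> s t /eq_in_map st; apply: invg_inj; apply/permP => i.
by apply: st; rewrite mem_enum.
Qed.

Lemma mem_source_seq s i : i \in source_seq s.
Proof. by apply/mapP; exists (s i); rewrite ?mem_enum // permK. Qed.

Lemma source_seq_surj w : uniq w -> (forall i, i \in w) -> exists s, source_seq s = w.
Proof.
move=> wU wT.
have sw : size w = (k + l)%N.
  by rewrite -(card_uniqP wU) -[RHS]card_ord; apply: eq_card => i; rewrite wT.
pose g (i : 'I_(k + l)) := tnth (Tuple (introT eqP sw)) i.
have gI : injective g.
  move=> i j; rewrite /g !(tnth_nth i) /= => /eqP.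
  by rewrite nth_uniq ?sw // => /eqP/val_inj.
exists (perm gI)^-1%g; rewrite /source_seq invgK.
rewrite -[RHS](map_tnth_enum (Tuple (introT eqP sw))).
by apply: eq_map => i; rewrite permE.
Qed.

(** [source_seq s] is sorted for the relation [s i < s j]. Filtering it thus yields each block
    sorted by [s], and [s] is a shuffle exactly when this is the natural order of both blocks. *)
Lemma shuffleE s : shuffle s = (source_seq s \in shuffles lows highs).
Proof.
rewrite (shuffles_sepE lows_low highs_high).
pose r (i j : 'I_(k + l)) := (s i < s j)%N.
have rT : transitive r by move=> ? ? ?; exact: ltn_trans.
have rI : irreflexive r by move=> ?; exact: ltnn.
have rs : pairwise r (source_seq s).
  rewrite pairwise_map; apply: sub_pairwise (pairwise_enum _) => i j.
  by rewrite /r /= !permKV.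
apply/idP/idP => [/forallP sh|/andP[/eqP fl /eqP fh]].
  have sh' i j := implyP (forallP (sh i) j).
  apply/andP; split; apply/eqP; apply: (irr_sorted_eq rT rI).
  - by rewrite (sorted_pairwise rT) pairwise_filter.
  - rewrite (sorted_pairwise rT).
    apply: (sub_in_pairwise _ lows_low lows_incr) => i j ik jk ij.
    by apply: sh'; rewrite ij; apply/orP; left.
  - by move=> i; rewrite mem_filter mem_source_seq andbT mem_lows.
  - by rewrite (sorted_pairwise rT) pairwise_filter.
  - rewrite (sorted_pairwise rT).
    apply: (sub_in_pairwise _ highs_high highs_incr) => i j ik jk ij.
    by apply: sh'; rewrite ij; apply/orP; right; rewrite leqNgt.
  - by move=> i; rewrite mem_filter mem_source_seq andbT mem_highs.
have rlows : pairwise r lows by rewrite -fl pairwise_filter.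
have rhighs : pairwise r highs by rewrite -fh pairwise_filter.
have enumP n (r' : rel 'I_n) : pairwise r' (enum 'I_n) ->
    forall i j : 'I_n, (i < j)%N -> r' i j.
  move=> pr i j ij; have := pairwiseP i pr i j; rewrite !inE !size_enum_ord.
  by rewrite !nth_ord_enum; apply.
move: rlows; rewrite pairwise_map => /enumP rl.
move: rhighs; rewrite pairwise_map => /enumP rh.
apply/forallP => i; apply/forallP => j; apply/implyP => /andP[].
(* The mixed cases are excluded: [i] low and [j] high by the block condition, the converse by
   [i < j]. *)
case: (split_ordP i) => i' ->; case: (split_ordP j) => j' -> /= ij; rewrite -/(r _ _).
- by move=> _; exact: rl.
- by rewrite leqNgt ltn_ord.
- by rewrite ltnNge (leq_trans (ltnW (ltn_ord j')) (leq_addr _ _)) in ij.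
- by move=> _; apply: rh; rewrite ltn_add2l in ij.
Qed.

Lemma big_shuffle (T : Type) (V : nmodType) (u : k.-tuple T) (v : l.-tuple T)
    (F : seq T -> V) m :
  \sum_(s | shuffle s && first_comes_from m s) F (interleave s u v) =
  \sum_(w <- shuffles lows highs | head m (map val w) == m)
    F (map (tnth (cat_tuple u v)) w).
Proof.
have -> : \sum_(s | shuffle s && first_comes_from m s) F (interleave s u v) =
    \sum_(w <- map source_seq (enum (@shuffle k l)) | head m (map val w) == m)
      F (map (tnth (cat_tuple u v)) w).
  rewrite big_map big_enum_cond /=; apply: eq_big => [s|s _]; last first.
    by rewrite /source_seq -map_comp.
  congr (_ && _); rewrite /source_seq /first_comes_from.
  (* If [k + l = 0], both conditions hold: [first_comes_from] vacuously, the other by the default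
     [m] of [head]. *)
  case: (k + l)%N s => [|n] s.
    by rewrite enum_ord0 eqxx; apply/forallP => -[].
  rewrite enum_ordSl /=; apply/forallP/idP => [/(_ ord0)//|s0 i].
  by apply/implyP => /eqP i0; rewrite (_ : i = ord0) //; apply/val_inj.
apply: perm_big; apply: uniq_perm.
- by rewrite map_inj_uniq ?enum_uniq //; exact: source_seq_inj.
- exact: shuffles_uniq lows_low highs_high.
move=> w; apply/mapP/idP => [[s + ->]|ws]; first by rewrite mem_enum -shuffleE.
have /andP[/eqP wl /eqP wh] : (filter low w == lows) && (filter (predC low) w == highs).
  by rewrite -(shuffles_sepE lows_low highs_high).
(* Being a rearrangement of all positions, [w] is the one-line notation of some [s^-1]. *)
have wE : perm_eq w (lows ++ highs) by rewrite -wl -wh perm_sym perm_filterC.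
have [|i|s sw] := @source_seq_surj w.
- have -> : uniq w = uniq (lows ++ highs) := perm_uniq wE.
  rewrite cat_uniq (map_inj_uniq (@lshift_inj _ _)) (map_inj_uniq (@rshift_inj _ _)).
  rewrite !enum_uniq andbT /=.
  by apply/hasPn => i; rewrite mem_highs mem_lows.
- by rewrite (perm_mem wE) mem_cat mem_lows mem_highs orbN.
- by exists s => //; rewrite mem_enum; apply: etrans ws; rewrite -sw; exact: shuffleE.
Qed.
End shuffle_permutations.

Lemma map_tnth_lshift T k l (u : k.-tuple T) (v : l.-tuple T) :
  map (tnth (cat_tuple u v)) [seq lshift l i | i <- enum 'I_k] = u.
Proof.
by rewrite -map_comp -[RHS]map_tnth_enum; apply: eq_map => i; exact: tnth_lshift.
Qed.

Lemma map_tnth_rshift T k l (u : k.-tuple T) (v : l.-tuple T) :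
  map (tnth (cat_tuple u v)) [seq rshift k i | i <- enum 'I_l] = v.
Proof.
by rewrite -map_comp -[RHS]map_tnth_enum; apply: eq_map => i; exact: tnth_rshift.
Qed.

(** * Sums over shuffles with a prescribed first entry *)

Section head_of_shuffle.
Variables (T : eqType) (V : nmodType) (P : pred (seq T)) (x : T).
Variables (u v : seq T) (F : seq T -> V).
Hypothesis Px : forall w, P (x :: w).

Lemma big_shuffles_head_left : (forall b w, b \in v -> P (b :: w) = false) ->
  \sum_(w <- shuffles (x :: u) v | P w) F w = \sum_(w <- shuffles u v) F (x :: w).
Proof.
case: v => [|b v'] Pv; first by rewrite !shuffless0 big_cons !big_nil Px big_seq1 addr0.
rewrite shuffles_cons big_cat !big_map /= [X in _ + X]big_pred0 ?addr0 => [|w]; last first.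
  by rewrite Pv ?mem_head.
by apply: eq_bigl => w; rewrite Px.
Qed.

Lemma big_shuffles_head_right : (forall b w, b \in u -> P (b :: w) = false) ->
  \sum_(w <- shuffles u (x :: v) | P w) F w = \sum_(w <- shuffles u v) F (x :: w).
Proof.
case: u => [|b u'] Pu; first by rewrite !shuffles0s big_cons !big_nil Px big_seq1 addr0.
rewrite shuffles_cons big_cat !big_map /= big_pred0 ?add0r => [|w]; last by rewrite Pu ?mem_head.
by apply: eq_bigl => w; rewrite Px.
Qed.
End head_of_shuffle.

(** The first entry is selected on positions, which are distinct; [shuffles_map] then replaces
    positions by letters, which may repeat. *)
Lemma big_shuffle_prec T (V : nmodType) (a : T) u v (F : seq T -> V) :
  \sum_(s | shuffle_prec s) F (interleave s (in_tuple (a :: u)) (in_tuple v)) =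
  \sum_(w <- shuffles u v) F (a :: w).
Proof.
rewrite big_shuffle; set g := tnth _.
have gu := map_tnth_lshift (in_tuple (a :: u)) (in_tuple v).
have gv := map_tnth_rshift (in_tuple (a :: u)) (in_tuple v).
rewrite -/g enum_ordSl /= in gu gv *.
have ga := congr1 (head a) gu; move/(congr1 behead): gu => /= gu.
rewrite big_shuffles_head_left //=; last by move=> _ w /mapP[i _ ->].
rewrite -[in RHS]gv -[X in shuffles X (map g _)]gu shuffles_map big_map.
by apply: eq_bigr => w _; congr (F (_ :: _)); exact: ga.
Qed.

Lemma big_shuffle_succ T (V : nmodType) (b : T) u v (F : seq T -> V) :
  \sum_(s | shuffle_succ s) F (interleave s (in_tuple u) (in_tuple (b :: v))) =
  \sum_(w <- shuffles u v) F (b :: w).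
Proof.
rewrite big_shuffle; set g := tnth _.
have gu := map_tnth_lshift (in_tuple u) (in_tuple (b :: v)).
have gv := map_tnth_rshift (in_tuple u) (in_tuple (b :: v)).
rewrite -/g enum_ordSl /= in gu gv *.
have gb := congr1 (head b) gv; move/(congr1 behead): gv => /= gv.
rewrite big_shuffles_head_right //=.
- rewrite -[in RHS]gu -[X in shuffles (map g _) X]gv shuffles_map big_map.
  by apply: eq_bigr => w _; congr (F (_ :: _)); exact: gb.
(* The first position of the second block has value [size u + 0]. *)
- by rewrite addn0.
by move=> _ w /mapP[i _ ->] /=; rewrite ltn_eqF.
Qed.

(** * Linear and bilinear maps determined on a basis *)

(** Linearity is taken as a proposition, the form in which [dend_morphism] provides it, and packed
    into structures inside the proof. *)
Lemma malg_linear_ext (K : fieldType) (X : choiceType) (V : lmodType K)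
    (f g : {malg K[X]} -> V) : linear f -> linear g ->
  (forall x, f << x >> = g << x >>) -> f =1 g.
Proof.
move=> fl gl fg p.
pose fL : {linear _ -> _} := HB.pack f (GRing.isLinear.Build K _ _ *:%R f fl).
pose gL : {linear _ -> _} := HB.pack g (GRing.isLinear.Build K _ _ *:%R g gl).
rewrite -[f]/(fL : _ -> _) -[g]/(gL : _ -> _) (monalgE p) !linear_sum.
apply: eq_bigr => x _; have -> : << p@_x *g x >> = p@_x *: << x >> :> {malg K[X]}.
  by apply/malgP => y; rewrite mcoeffZ !mcoeffU mulrnAr mulr1.
by rewrite !linearZ /= fg.
Qed.

Lemma linext_sum (K : fieldType) (X : choiceType) (V : lmodType K) (f : X -> V)
    (I : Type) (c : seq I) (g : I -> X) :
  linext f (\sum_(i <- c) << g i >>) = \sum_(i <- c) f (g i).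
Proof. by rewrite linear_sum; apply: eq_bigr => i _; rewrite /= linextU. Qed.

Section bilinear_maps.
Variables (K : fieldType) (X Y : choiceType) (V : lmodType K).

Lemma bilextUU (f : X -> Y -> V) x y : bilext f << x >> << y >> = f x y.
Proof. by rewrite /bilext !linextU. Qed.

Lemma bilext_linearl (f : X -> Y -> V) q : linear (bilext f ^~ q).
Proof. by move=> c p p'; rewrite /bilext linearP. Qed.

Lemma bilext_linearr (f : X -> Y -> V) p : linear (bilext f p).
Proof.
move=> c q q'; rewrite /bilext /linext scaler_sumr -big_split /=.
apply: eq_bigr => x _; rewrite -!/(linext _ _) linearP scalerDr !scalerA.
by rewrite mulrC.
Qed.

Lemma malg_bilinear_ext (f g : {malg K[X]} -> {malg K[Y]} -> V) :
  (forall q, linear (f ^~ q)) -> (forall p, linear (f p)) ->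
  (forall q, linear (g ^~ q)) -> (forall p, linear (g p)) ->
  (forall x y, f << x >> << y >> = g << x >> << y >>) -> f =2 g.
Proof.
move=> fl fr gl gr fg p q; apply: (malg_linear_ext (fl q) (gl q)) p => x.
exact: (malg_linear_ext (fr _) (gr _) (fg x)). 
Qed.
End bilinear_maps.

(** * The shuffle algebra of words *)

Section word_algebra.
Variable K : fieldType.
Implicit Types (u v w : word) (p q r : W K) (z : letter).

Lemma wcons_linear z : linear (@wcons K z).
Proof. exact: linearP. Qed.

HB.instance Definition _ z :=
  GRing.isLinear.Build K (W K) (W K) *:%R (@wcons K z) (wcons_linear z).

Lemma wconsU z w : wcons z << w >> = << z :: w >> :> W K.
Proof. exact: linextU. Qed.

Lemma wconsD z p q : wcons z (p + q) = wcons z p + wcons z q.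
Proof. exact: linearD. Qed.

Lemma word_shuffleE u v : word_shuffle K u v = \sum_(w <- shuffles u v) << w >>.
Proof.
have consE z s : \sum_(w <- map (cons z) s) << w >> = wcons z (\sum_(w <- s) << w >>) :> W K.
  by rewrite big_map linear_sum; apply: eq_bigr => w _; rewrite -wconsU.
elim: u v => [|a u IHu] v; first by rewrite shuffles0s big_seq1; case: v.
elim: v => [|b v IHv]; first by rewrite shuffless0 big_seq1.
by rewrite shuffles_cons big_cat /= !consE -IHu -IHv.
Qed.

Lemma wshuffle_linearl q : linear ((@wshuffle K) ^~ q).
Proof. exact: bilext_linearl. Qed.

Lemma wshuffle_linearr p : linear (@wshuffle K p).
Proof. exact: bilext_linearr. Qed.

Lemma wshuffleDl p q r : wshuffle (p + q) r = wshuffle p r + wshuffle q r.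
Proof. by have := wshuffle_linearl r 1 p q; rewrite !scale1r. Qed.

Lemma wshuffleDr p q r : wshuffle p (q + r) = wshuffle p q + wshuffle p r.
Proof. by have := wshuffle_linearr p 1 q r; rewrite !scale1r. Qed.

Lemma wshuffle1r q : wshuffle << [::] >> q = q.
Proof.
apply: (malg_linear_ext (wshuffle_linearr _) (fun _ _ _ => erefl)) q => v.
by rewrite /wshuffle bilextUU word_shuffleE shuffles0s big_seq1.
Qed.

Lemma wshuffler1 p : wshuffle p << [::] >> = p.
Proof.
apply: (malg_linear_ext (wshuffle_linearl _) (fun _ _ _ => erefl)) p => u.
by rewrite /wshuffle bilextUU word_shuffleE shuffless0 big_seq1.
Qed.

(** On words this is the definition of [word_shuffle]; bilinearity extends it to the sums of words
    that products produce. *)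
Lemma wshuffle_cons a b p q :
  wshuffle (wcons a p) (wcons b q) =
  wcons a (wshuffle p (wcons b q)) + wcons b (wshuffle (wcons a p) q).
Proof.
apply: (malg_bilinear_ext
  (f := fun p q => wshuffle (wcons a p) (wcons b q))
  (g := fun p q => wcons a (wshuffle p (wcons b q)) + wcons b (wshuffle (wcons a p) q)))
  => {p q} [q|p|q|p|u v] => [c p p'|c q q'|c p p'|c q q'|].
- by rewrite wcons_linear wshuffle_linearl.
- by rewrite wcons_linear wshuffle_linearr.
- rewrite wcons_linear !wshuffle_linearl !wcons_linear scalerDr.
  by rewrite !addrA; congr (_ + _); rewrite addrAC.
- rewrite wcons_linear !wshuffle_linearr !wcons_linear scalerDr.
  by rewrite !addrA; congr (_ + _); rewrite addrAC.
by rewrite !wconsU /wshuffle !bilextUU.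
Qed.

(* Stated for abstract operations because on [W K] itself matching modulo conversion
   unfolds [linext] in search of additions and does not terminate in practice. *)
Lemma shuffle_assoc_step (L : Type) (V : nmodType) (m : V -> V -> V) (c : L -> V -> V) :
    (forall x y t, m (x + y) t = m x t + m y t) ->
    (forall x y t, m x (y + t) = m x y + m x t) ->
    (forall i x y, c i (x + y) = c i x + c i y) ->
    (forall i j x y, m (c i x) (c j y) = c i (m x (c j y)) + c j (m (c i x) y)) ->
  forall i j k x y t,
    m (m x (c j y)) (c k t) = m x (m (c j y) (c k t)) ->
    m (m (c i x) y) (c k t) = m (c i x) (m y (c k t)) ->
    m (m (c i x) (c j y)) t = m (c i x) (m (c j y) t) ->
  m (m (c i x) (c j y)) (c k t) = m (c i x) (m (c j y) (c k t)).
Proof.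
move=> mDl mDr cD E i j k x y t Hx Hy Ht.
rewrite [in LHS]E [X in _ = m _ X]E mDl mDr 4!E.
(* On the left the two terms under [c k] merge, on the right the two under [c i]; each side is then
   one term for each first letter [i], [j], [k]. *)
rewrite addrACA -cD -mDl -E Hx Hy Ht.
by rewrite [RHS]addrACA -[X in _ = X + _]cD -mDr -E addrA.
Qed.

(** Trilinearity reduces to words. There the three nested inductions supply the instances with one
    first letter removed that [shuffle_assoc_step] takes, and the unit laws settle empty words. *)
Lemma wshuffleA p q r : wshuffle (wshuffle p q) r = wshuffle p (wshuffle q r).
Proof.
move: p q; apply: malg_bilinear_ext => [q|p|q|p|u v] => [c p p'|c q q'|c p p'|c q q'|].
- by rewrite !wshuffle_linearl.
- by rewrite wshuffle_linearr wshuffle_linearl.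
- by rewrite wshuffle_linearl.
- by rewrite wshuffle_linearl wshuffle_linearr.
move: r; apply: malg_linear_ext => [c r r'|c r r'|w].
- by rewrite wshuffle_linearr.
- by rewrite !wshuffle_linearr.
elim: u v w => [|a u IHu] v w; first by rewrite !wshuffle1r.
elim: v w => [|b v IHv] w; first by rewrite wshuffler1 wshuffle1r.
elim: w => [|c w IHw]; first by rewrite !wshuffler1.
have := shuffle_assoc_step wshuffleDl wshuffleDr wconsD wshuffle_cons.
move=> /(_ a b c << u >> << v >> << w >>); rewrite !wconsU; apply.
- exact: IHu.
- exact: IHv.
- exact: IHw.
Qed.

End word_algebra.

(** * Products of trees and the flattening map *)

Section tree_shuffles.
Variable K : fieldType.
Implicit Types (t s l r : btree) (z : letter).

(** The total product [prec + succ], with [Leaf] as unit, including against itself. *)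
Definition tree_star t s : {malg K[btree]} :=
  \sum_(w <- shuffles (right_spine t) (left_spine s)) << ladder w >>.

Lemma ladder_right_spine t : ladder (right_spine t) = t.
Proof. by elim: t => //= z l _ r ->. Qed.

Lemma ladder_left_spine t : ladder (left_spine t) = t.
Proof. by elim: t => //= z l -> r _. Qed.

Lemma tree_star_leafl s : tree_star Leaf s = << s >>.
Proof. by rewrite /tree_star shuffles0s big_seq1 ladder_left_spine. Qed.

Lemma tree_star_leafr t : tree_star t Leaf = << t >>.
Proof. by rewrite /tree_star shuffless0 big_seq1 ladder_right_spine. Qed.

(** The right spine of [Node z l r] is its root followed by that of [r], so keeping this root first
    leaves the shuffles of the spines of [r] and [s]. *)
Lemma tree_precE z l r s :
  tree_prec K (Node z l r) s = linext (fun t => << Node z l t >>) (tree_star r s).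
Proof.
rewrite linext_sum; case: s => [|z' l' r'].
  by rewrite shuffless0 big_seq1 ladder_right_spine.
exact: (big_shuffle_prec (true, z, l) _ _ (fun w => << ladder w >>)).
Qed.

Lemma tree_succE t z l r :
  tree_succ K t (Node z l r) = linext (fun s => << Node z s r >>) (tree_star t l).
Proof.
rewrite linext_sum; case: t => [|z' l' r'].
  by rewrite shuffles0s big_seq1 ladder_left_spine.
exact: (big_shuffle_succ (false, z, r) _ _ (fun w => << ladder w >>)).
Qed.

Lemma tree_star_nodes z l r z' l' r' :
  tree_star (Node z l r) (Node z' l' r') =
  linext (fun t => << Node z l t >>) (tree_star r (Node z' l' r')) +
  linext (fun s => << Node z' s r' >>) (tree_star (Node z l r) l').
Proof. by rewrite !linext_sum [LHS]big_cat /= !big_map. Qed.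

Lemma flat_linear : linear (@flat K).
Proof. exact: linearP. Qed.

Lemma flatU t : flat << t >> = flat_tree K t.
Proof. exact: linextU. Qed.

Lemma flat_nodel z l p :
  flat (linext (fun t => << Node z l t >>) p) = wcons z (wshuffle (flat_tree K l) (flat p)).
Proof.
move: p; apply: malg_linear_ext => [c p q|c p q|t].
- by rewrite linearP flat_linear.
- by rewrite flat_linear wshuffle_linearr wcons_linear.
by rewrite linextU !flatU.
Qed.

Lemma flat_noder z r p :
  flat (linext (fun t => << Node z t r >>) p) = wcons z (wshuffle (flat p) (flat_tree K r)).
Proof.
move: p; apply: malg_linear_ext => [c p q|c p q|t].
- by rewrite linearP flat_linear.
- by rewrite flat_linear wshuffle_linearl wcons_linear.
by rewrite linextU !flatU.
Qed.

(** Induction along the right branch of [t] and the left branch of [s], the two branches that are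
    shuffled. *)
Lemma flat_tree_star t s :
  flat (tree_star t s) = wshuffle (flat_tree K t) (flat_tree K s).
Proof.
elim: t s => [|z l _ r IHr] s.
  by rewrite tree_star_leafl wshuffle1r flatU.
elim: s => [|z' l' IHl' r' _].
  by rewrite tree_star_leafr wshuffler1 flatU.
have flatD (p q : Dend K) : flat (p + q) = flat p + flat q by exact: linearD.
rewrite tree_star_nodes flatD flat_nodel flat_noder IHr IHl'.
(* Associativity groups the flattenings of [l] and [r] in the first term, and those of [l'] and [r']
   in the second, as [wshuffle_cons] requires. *)
rewrite -(wshuffleA (flat_tree K l)) (wshuffleA _ (flat_tree K l')).
exact/esym/wshuffle_cons.
Qed.

Lemma dend_morphism_unique (E : augDend K) (f g : Dend K -> E) :
  dend_morphism f -> dend_morphism g ->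
  (forall z, f << Y z >> = g << Y z >>) -> f = g.
Proof.
move=> [fl f1 _ fp fs] [gl g1 _ gp gs] fgY; apply/boolp.funext.
apply: (malg_linear_ext fl gl).
have augU z l r : dend_aug (a := Dend K) << Node z l r >> by rewrite /= mcoeffU.
have nodeE z l r : << Node z l r >> = dend_prec (a := Dend K) << Node z l Leaf >> << r >>.
  by rewrite /= bilextUU tree_precE tree_star_leafl linextU.
have nodelE z l : << Node z l Leaf >> = dend_succ (a := Dend K) << l >> << Y z >>.
  by rewrite /= bilextUU tree_succE tree_star_leafr linextU.
elim=> [|z l IHl r IHr]; first by rewrite f1 g1.
have fgl : f << Node z l Leaf >> = g << Node z l Leaf >>.
  case: l IHl => [|z' l r'] IHl; first exact: fgY.
  have augs := (augU z' l r', augU z Leaf Leaf).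
  by rewrite nodelE (fs _ _ augs.1 augs.2) (gs _ _ augs.1 augs.2) IHl fgY.
case: r IHr => [|z' l' r'] IHr //.
have augs := (augU z l Leaf, augU z' l' r').
by rewrite nodeE (fp _ _ augs.1 augs.2) (gp _ _ augs.1 augs.2) fgl IHr.
Qed.
End tree_shuffles.

(** * Formal integrals and the composite [zetaFI \o flat] *)

Section zeta.
Variables (K : fieldType) (R : realType).
Implicit Types (u v : word) (p q : W K) (z : letter).

Lemma zetaFI_linear : linear (@zetaFI K R).
Proof. exact: linearP. Qed.

Lemma zetaFIU u : zetaFI R << u >> = simplexA K R u.
Proof. exact: linextU. Qed.

Lemma int_precE z u v :
  int_prec K R (z :: u) v = zetaFI R (wcons z (word_shuffle K u v)).
Proof.
rewrite word_shuffleE /wcons linext_sum [RHS]linext_sum.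
case: v => [|b v]; first by rewrite shuffless0 big_seq1.
exact: (big_shuffle_prec z u (b :: v)).
Qed.

Lemma int_succE z u v :
  int_succ K R u (z :: v) = zetaFI R (wcons z (word_shuffle K u v)).
Proof.
rewrite word_shuffleE /wcons linext_sum [RHS]linext_sum.
case: u => [|b u]; first by rewrite shuffles0s big_seq1.
exact: (big_shuffle_succ z (b :: u) v).
Qed.

Lemma bilext_int_prec z p q :
  bilext (@int_prec K R) (wcons z p) q = zetaFI R (wcons z (wshuffle p q)).
Proof.
apply: (malg_bilinear_ext
  (f := fun p q => bilext (@int_prec K R) (wcons z p) q)
  (g := fun p q => zetaFI R (wcons z (wshuffle p q))))
  => {p q} [q c p p'|p c q q'|q c p p'|p c q q'|u v].
- by rewrite wcons_linear bilext_linearl.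
- by rewrite bilext_linearr.
- by rewrite wshuffle_linearl wcons_linear zetaFI_linear.
- by rewrite wshuffle_linearr wcons_linear zetaFI_linear.
by rewrite wconsU /wshuffle !bilextUU int_precE.
Qed.

Lemma bilext_int_succ z p q :
  bilext (@int_succ K R) p (wcons z q) = zetaFI R (wcons z (wshuffle p q)).
Proof.
apply: (malg_bilinear_ext
  (f := fun p q => bilext (@int_succ K R) p (wcons z q))
  (g := fun p q => zetaFI R (wcons z (wshuffle p q))))
  => {p q} [q c p p'|p c q q'|q c p p'|p c q q'|u v].
- by rewrite bilext_linearl.
- by rewrite wcons_linear bilext_linearr.
- by rewrite wshuffle_linearl wcons_linear zetaFI_linear.
- by rewrite wshuffle_linearr wcons_linear zetaFI_linear.
by rewrite wconsU /wshuffle !bilextUU int_succE.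
Qed.

(** Valid on all of [Dend], hence checkable on basis trees: [tree_prec] and [int_prec] both vanish
    when the first argument is the unit. For other trees the regrouping is associativity of the
    shuffle product. *)
Lemma zetaFI_flat_prec (a b : Dend K) :
  zetaFI R (flat (dend_prec a b)) = bilext (@int_prec K R) (flat a) (flat b).
Proof.
move: a b; apply: malg_bilinear_ext => [b c a a'|a c b b'|b c a a'|a c b b'|t s].
- by rewrite /= bilext_linearl flat_linear zetaFI_linear.
- by rewrite /= bilext_linearr flat_linear zetaFI_linear.
- by rewrite flat_linear bilext_linearl.
- by rewrite flat_linear bilext_linearr.
rewrite /= bilextUU !flatU; case: t => [|z l r].
  rewrite /flat /zetaFI !linear0 /bilext linextU /linext big1 // => w _.
  exact: scaler0.
by rewrite tree_precE flat_nodel flat_tree_star bilext_int_prec wshuffleA.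
Qed.

Lemma zetaFI_flat_succ (a b : Dend K) :
  zetaFI R (flat (dend_succ a b)) = bilext (@int_succ K R) (flat a) (flat b).
Proof.
move: a b; apply: malg_bilinear_ext => [b c a a'|a c b b'|b c a a'|a c b b'|t s].
- by rewrite /= bilext_linearl flat_linear zetaFI_linear.
- by rewrite /= bilext_linearr flat_linear zetaFI_linear.
- by rewrite flat_linear bilext_linearl.
- by rewrite flat_linear bilext_linearr.
rewrite /= bilextUU !flatU; case: s => [|z l r]; last first.
  by rewrite tree_succE flat_noder flat_tree_star bilext_int_succ wshuffleA.
(* A unit on the right gives 0 for [tree_succ] and [int_succ] alike. *)
have -> : tree_succ K t Leaf = 0 by case: t.
rewrite /flat /zetaFI !linear0 /bilext /linext big1 // => u _.
rewrite [X in _ *: X](_ : _ = 0) ?scaler0 //.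
by apply: etrans (linextU _ _) _; case: u.
Qed.

Lemma mcoeff_nil_wcons z p : (wcons z p)@_[::] = 0.
Proof.
apply: (malg_linear_ext (V := K^o) (f := fun p : W K => (wcons z p)@_[::])
  (g := fun=> 0)) p => [c p q|c p q|w].
- by rewrite wcons_linear mcoeffD mcoeffZ.
- by rewrite scaler0 addr0.
by rewrite wconsU mcoeffU.
Qed.

(** Every tree but [Leaf] flattens to words with a first letter. Hence [flat] sends [dend_aug] to
    combinations of nonempty words. *)
Lemma mcoeff_nil_flat (a : Dend K) : (flat a)@_[::] = a@_Leaf.
Proof.
apply: (malg_linear_ext (V := K^o) (f := fun a : Dend K => (flat a)@_[::])
  (g := mcoeff Leaf)) a => [c a b|c a b|t].
- by rewrite flat_linear mcoeffD mcoeffZ.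
- by rewrite mcoeffD mcoeffZ.
by rewrite flatU; case: t => [|z l r]; rewrite ?mcoeff_nil_wcons !mcoeffU.
Qed.

Lemma zetaFI_flat_is_zetaDend : @is_zetaDend K R (@zetaFI K R \o @flat K).
Proof.
split; last by move=> z; rewrite /= flatU /= wshuffle1r wconsU zetaFIU.
split.
- by move=> c a b; rewrite /= flat_linear zetaFI_linear.
- by rewrite /= flatU zetaFIU.
- by move=> a a0; exists (flat a); rewrite // mcoeff_nil_flat.
(* The operations of [calA_dend] go through [wcoord], which inverts [zetaFI]. *)
- by move=> a b _ _; rewrite /= !zetaFIK; exact: zetaFI_flat_prec.
- by move=> a b _ _; rewrite /= !zetaFIK; exact: zetaFI_flat_succ.
Qed.
End zeta.

Theorem theorem7p5 (K : fieldType) (R : realType) :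
  exists2 zetaDend : Dend K -> calA_dend K R,
    unique (@is_zetaDend K R) zetaDend
  & @zetaFI K R \o @flat K = zetaDend.
Proof.
(* With the composite itself as witness the equality is immediate; existence and uniqueness of the
   morphism remain. *)
exists (@zetaFI K R \o @flat K) => //; split; first exact: zetaFI_flat_is_zetaDend.
move=> f [fm fY]; have [zm zY] := zetaFI_flat_is_zetaDend K R.
by apply: dend_morphism_unique => // z; rewrite zY fY.
Qed.
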